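(* Let $\mathcal{H}=\mathcal{H}(X)$ be a reproducing kernel Hilbert space on a nonempty set $X$, let $A\in\mathcal{B}(\mathcal{H})^+$, and let $M,N\in\mathcal{B}_A(\mathcal{H})$ have closed ranges, with the pairs $(A,\mathcal{R}(M))$, $(A,\mathcal{N}(M))$, $(A,\mathcal{R}(N))$ and $(A,\mathcal{N}(N))$ compatible. Let $M^{\dagger_A}$, $N^{\dagger_A}$ be $A$-generalized inverses of $M$ and $N$. Then $$\mathbf{ber}_A^2(M+N)\leq\frac12\left(\mathbf{ber}_A^2(M^{\#_A}M+iN^{\#_A}N)+\mathbf{ber}_A^2(MM^{\dagger_A}+iNN^{\dagger_A})\right)+\mathbf{ber}_A(N^{\#_A}M)+\sqrt{\mathbf{ber}_A(M^{\#_A}M)\,\mathbf{ber}_A(N^{\#_A}N)}.$$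
   Context: A reproducing kernel Hilbert space $\mathcal{H}(X)$ is a complex Hilbert space of complex-valued functions on $X$ on which every evaluation $\phi\mapsto\phi(x)$, $x\in X$, is continuous; $k_x\in\mathcal{H}$ is the element with $\phi(x)=\langle\phi,k_x\rangle$ for all $\phi\in\mathcal{H}$. $\mathcal{B}(\mathcal{H})$ is the algebra of bounded linear operators on $\mathcal{H}$, $\mathcal{B}(\mathcal{H})^+=\{T\in\mathcal{B}(\mathcal{H}):\langle Tu,u\rangle\ge0\ \forall u\in\mathcal{H}\}$; $\mathcal{R}(T)$, $\mathcal{N}(T)$ denote range and null space; $i$ is the imaginary unit. For $A\in\mathcal{B}(\mathcal{H})^+$: $\langle u,v\rangle_A=\langle Au,v\rangle$ and $\|u\|_A=\langle u,u\rangle_A^{1/2}$. $\mathcal{B}_A(\mathcal{H})=\{T\in\mathcal{B}(\mathcal{H}):\mathcal{R}(T^*A)\subseteq\mathcal{R}(A)\}$. For $T\in\mathcal{B}_A(\mathcal{H})$, $T^{\#_A}$ is the unique $Y\in\mathcal{B}(\mathcal{H})$ with $AY=T^*A$ and $\mathcal{R}(Y)\subseteq\overline{\mathcal{R}(A)}$; in particular $\langle Tu,v\rangle_A=\langle u,T^{\#_A}v\rangle_A$. For a closed subspace $V$, the pair $(A,V)$ is compatible if there is $Q\in\mathcal{B}(\mathcal{H})$ with $Q^2=Q$, $\mathcal{R}(Q)=V$, $AQ=Q^*A$. An $A$-generalized inverse of a closed-range operator $T$ is an operator $T^{\dagger_A}\in\mathcal{B}(\mathcal{H})$ with $TT^{\dagger_A}T=T$,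 $T^{\dagger_A}TT^{\dagger_A}=T^{\dagger_A}$, $ATT^{\dagger_A}=(TT^{\dagger_A})^*A$, $AT^{\dagger_A}T=(T^{\dagger_A}T)^*A$. (Known: it exists if and only if $(A,\mathcal{R}(T))$ and $(A,\mathcal{N}(T))$ are compatible.) The $A$-normalized reproducing kernel is $\hat k_x'=k_x/\|k_x\|_A$, for those $x\in X$ with $\|k_x\|_A\neq0$. The $A$-Berezin number is $\mathbf{ber}_A(T)=\sup_{x}|\langle T\hat k_x',\hat k_x'\rangle_A|$, the supremum being over $x\in X$ with $\|k_x\|_A\ne0$. $\mathbf{ber}_A^{p}(T)$ means $(\mathbf{ber}_A(T))^p$. *)

(* Defs.v *)
From HB Require Import structures.
From mathcomp Require Import all_boot all_order all_algebra sesquilinear complex.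
From mathcomp Require Import all_classical all_reals all_analysis.
Set Implicit Arguments.
Unset Strict Implicit.
Unset Printing Implicit Defensive.
Import Order.TTheory GRing.Theory Num.Theory.
Import numFieldNormedType.Exports.
Local Open Scope classical_set_scope.
Local Open Scope ring_scope.
Local Open Scope complex_scope.

(* The order of R[i] is the partial one: 0 <= z means that z is a nonnegative
   real. Inner products are linear in the first argument. *)

(* The injectivity of rkhs_eval, together with its linearity, identifies the
   carrier with a linear space of functions X -> R[i]; addition and scaling
   are then the pointwise ones. The topology is put on R[i] through R[i]^o. *)
Record rkhs (R : realType) (X : Type) := RKHS {
  rkhs_space :> completeNormedModType R[i] ;
  rkhs_inner : {dot rkhs_space for @Num.conj R[i]} ;
  rkhs_normE : forall u : rkhs_space, `|u| ^+ 2 = rkhs_inner u u ;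
  rkhs_eval : rkhs_space -> X -> R[i] ;
  rkhs_eval_linear : forall (x : X) (a : R[i]) (u v : rkhs_space),
    rkhs_eval (a *: u + v) x = a * rkhs_eval u x + rkhs_eval v x ;
  rkhs_eval_inj : injective rkhs_eval ;
  rkhs_eval_continuous : forall x : X,
    continuous (fun u : rkhs_space => rkhs_eval u x : R[i]^o) }.

Section Operators.
Context {R : realType} {X : Type} {H : rkhs R X}.
Implicit Types (A T S Y Q : H -> H) (V : set H) (k : X -> H).

Local Notation "'[ u , v ]" := (rkhs_inner H u v) : ring_scope.

Definition is_reproducing_kernel k :=
  forall (phi : H) (x : X), rkhs_eval phi x = '[phi, k x].

Definition bounded_op T := linear T /\ continuous T.

Definition positive_op A := bounded_op A /\ forall u, 0 <= '[A u, u].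

Definition null_space T : set H := [set u | T u = 0].

(* S is T^*; such an S is unique, and it exists when T is bounded. *)
Definition is_adjoint T S := forall u v, '[T u, v] = '[u, S v].

(* A Q = Q^* A *)
Definition A_selfadjoint A Q :=
  exists2 Qs, is_adjoint Q Qs & A \o Q = Qs \o A.

Definition in_BA A T := bounded_op T /\
  exists2 Ts, is_adjoint T Ts & range (Ts \o A) `<=` range A.

(* Y is T^{#_A}; such a Y is unique, and it exists when in_BA A T. *)
Definition is_sharp A T Y :=
  [/\ bounded_op Y,
      exists2 Ts, is_adjoint T Ts & A \o Y = Ts \o A
    & range Y `<=` closure (range A)].

Definition compatible A V := closed V /\
  exists Q, [/\ bounded_op Q, Q \o Q = Q, range Q = V & A_selfadjoint A Q].

(* G is an A-generalized inverse of T. *)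
Definition is_A_ginv A T G :=
  [/\ bounded_op G, T \o G \o T = T, G \o T \o G = G,
      A_selfadjoint A (T \o G) & A_selfadjoint A (G \o T)].

Definition A_inner A (u v : H) : R[i] := '[A u, v].

(* A_inner A u u is a nonnegative real when A is positive, so that taking its
   real part is harmless. *)
Definition A_norm A (u : H) : R := Num.sqrt (complex.Re (A_inner A u u)).

Definition A_normalized A k (x : X) : H := (A_norm A (k x))^-1%:C *: k x.

(* The modulus of a complex number is an element of R[i], with zero imaginary
   part. The supremum is that of R: it is 0 for the empty set (which occurs
   exactly when A = 0), and is meaningful for operators that are bounded for
   the seminorm A_norm A, in particular for those satisfying in_BA A. *)
Definition ber k A T : R :=
  sup [set complex.Re `|A_inner A (T (A_normalized A k x)) (A_normalized A k x)|
      | x in [set x : X | A_norm A (k x) != 0]].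

End Operators.

(* Main.v *)
Require Import Defs.
From HB Require Import structures.
From mathcomp Require Import all_boot all_order all_algebra sesquilinear complex.
From mathcomp Require Import all_classical all_reals all_analysis.
From mathcomp Require Import ring lra.
Set Implicit Arguments.
Unset Strict Implicit.
Unset Printing Implicit Defensive.
Import Order.TTheory GRing.Theory Num.Theory.
Import numFieldNormedType.Exports.
Local Open Scope classical_set_scope.
Local Open Scope ring_scope.
Local Open Scope complex_scope.

(** Write [ip u v] for the form [<Au, v>] and [nA] for its seminorm, and fix a
    vector [f] with [nA f = 1].  The estimate is pointwise: it bounds
    [|ip (Mf + Nf) f|^2 <= (|ip (Mf) f| + |ip (Nf) f|)^2] for each such [f].

    The two squares come from a mixed Cauchy-Schwarz inequality
    ([A_ginv_mixed_schwarz]): [P = M Mg] is an idempotent that is symmetric for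
    [ip] and satisfies [P M = M], so [ip (Mf) f = ip (Mf) (Pf)] and
    [|ip (Mf) f|^2 <= nA (Mf)^2 nA (Pf)^2], which is at most half the sum of the
    fourth powers of the two seminorms.  Since [nA (Mf)^2 = ip (Ms M f) f] and
    [nA (Pf)^2 = ip (P f) f] are real, combining the terms of [M] and of [N] by
    means of the imaginary unit adds squares of moduli:
    [nA (Mf)^4 + nA (Nf)^4 = |ip ((Ms M + i Ns N) f) f|^2], and likewise for the
    projections.  The cross term [2 |ip (Mf) f| |ip (Nf) f|] is bounded by
    [nA (Mf) nA (Nf) + |ip (Mf) (Nf)|], which is Buzano's inequality
    ([A_buzano]); here [ip (Mf) (Nf) = ip (Ns M f) f].

    Replacing pointwise values by suprema on the right requires the suprema to
    be taken over bounded sets, because the supremum of an unbounded set of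
    reals is 0 by convention.  So [M] must be bounded for the seminorm [nA] as
    soon as it has a sharp ([is_sharp_A_bounded]).  As [Ms M] is bounded on the
    Hilbert space and symmetric for [ip], this is a theorem of Krein and Lax
    ([A_symmetric_bounded]): the sequence [nA (S^n u)] of a symmetric [S] is
    logarithmically convex, hence grows at least as fast as the geometric
    sequence of ratio [nA (Su) / nA u], whereas it is dominated by the powers of
    the Hilbert space bound of [S]. *)

Import Normc.

Section Modulus.
Context {R : realType}.

Lemma normc_ge0 (z : R[i]) : 0 <= normc z.
Proof. by case: z => a b; exact: sqrtr_ge0. Qed.

Lemma normc_real (x : R) : 0 <= x -> normc x%:C = x.
Proof. by move=> x_ge0; rewrite /= expr0n addr0 sqrtr_sqr ger0_norm. Qed.

Lemma normc_conj (z : R[i]) : normc (conjc z) = normc z.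
Proof. by case: z => a b /=; rewrite sqrrN. Qed.

Lemma normc_sqr_addi (a b : R) :
  normc (a%:C + 'i%C * b%:C) ^+ 2 = a ^+ 2 + b ^+ 2.
Proof. by simpc; rewrite /= sqr_sqrtr ?addr_ge0 ?sqr_ge0. Qed.

End Modulus.

Lemma geometric_dominated (R : realType) (r c x K : R) : 0 < c -> 0 < x ->
  (forall n, r ^+ n * x <= K * c ^+ n) -> r <= c.
Proof.
move=> c_gt0 x_gt0 rcK; rewrite leNgt; apply/negP => cr.
have r_gt0 : 0 < r by exact: lt_trans cr.
have q1 : `|c / r| < 1 by rewrite gtr0_norm ?divr_gt0// ltr_pdivrMr// mul1r.
have K_gt0 : 0 < K.
  by apply: lt_le_trans x_gt0 _; have := rcK 0%N; rewrite !expr0 mul1r mulr1.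
have [n] := filter_ex (cvgr_lt _ (cvg_expr q1) _ (divr_gt0 x_gt0 K_gt0)).
rewrite /= expr_div_n ltr_pdivlMr// mulrAC ltr_pdivrMr ?exprn_gt0//.
by rewrite mulrC [x * _]mulrC ltNge rcK.
Qed.

(** * The semi-inner product of a positive operator *)

Definition A_symmetric (R : realType) (X : Type) (H : rkhs R X)
    (A S : H -> H) :=
  forall u v, A_inner A (S u) v = A_inner A u (S v).

Section SemiInner.
Context {R : realType} {X : Type} {H : rkhs R X} {A : H -> H}.
Context (A_pos : positive_op A).
Implicit Types (u v w f : H) (T P Y G : H -> H).

Local Notation ip := (A_inner A).
Local Notation nA := (A_norm A).

Lemma rkhs_innerC u v : rkhs_inner H u v = conjc (rkhs_inner H v u).
Proof. by rewrite (hermC (rkhs_inner H)) expr0 mul1r. Qed.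

Let A_lin : linear A := A_pos.1.1.

Lemma A_innerDl u v w : ip (u + v) w = ip u w + ip v w.
Proof. by rewrite /A_inner -[u]scale1r A_lin linearPl scale1r/= mul1r. Qed.

Lemma A_innerDr u v w : ip u (v + w) = ip u v + ip u w.
Proof. exact: linearDr. Qed.

Lemma A_innerZl a u w : ip (a *: u) w = a * ip u w.
Proof.
have := A_lin a u 0; rewrite !addr0 => E.
have A0 : A 0 = 0 by have := A_lin (-1) 0 0; rewrite !scaleN1r !addNr.
by rewrite /A_inner E A0 addr0 linearZl_LR.
Qed.

Lemma A_innerZr a u v : ip u (a *: v) = conjc a * ip u v.
Proof. exact: (linearZr_LR (rkhs_inner H)). Qed.

Lemma A_inner_ge0 u : 0 <= ip u u.
Proof. exact: A_pos.2. Qed.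

(** A positive operator on a complex space is self-adjoint: the values at
    [u + v] and at [u + i v] are real, which gives the imaginary and the real
    part of the identity. *)
Lemma A_innerC u v : ip u v = conjc (ip v u).
Proof.
have im0 w : complex.Im (ip w w) = 0 by rewrite ger0_Im ?A_inner_ge0.
have := im0 (u + v); have := im0 (u + 'i%C *: v).
rewrite !(A_innerDl, A_innerDr, A_innerZl, A_innerZr).
have := im0 u; have := im0 v.
case: (ip u u) (ip u v) (ip v u) (ip v v) => [a b] [c d] [e f] [g h] /=.
by move=> -> -> *; congr (_ +i* _)%C; lra.
Qed.

Lemma A_norm_ge0 u : 0 <= nA u.
Proof. exact: sqrtr_ge0. Qed.

Lemma A_inner_diag u : ip u u = (nA u ^+ 2)%:C.
Proof.
have := A_inner_ge0 u; rewrite /A_norm; case: (ip u u) => a b.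
by rewrite lecE /= => /andP[/eqP -> a0]; rewrite sqr_sqrtr.
Qed.

Lemma normc_A_innerC u v : normc (ip u v) = normc (ip v u).
Proof. by rewrite A_innerC normc_conj. Qed.

Lemma normc_A_inner_diag u : normc (ip u u) = nA u ^+ 2.
Proof. by rewrite A_inner_diag normc_real ?sqr_ge0. Qed.

(** The vectors [u - t (ip u v) v] with [t] real serve twice: minimizing over [t]
    gives Cauchy-Schwarz, and for [t = 2] and [nA v = 1] the map
    [u |-> u - t (ip u v) v] is a reflection, which preserves [nA]. *)
Lemma A_norm_sub_sqr u v (t : R) :
  nA (u - (t%:C * ip u v) *: v) ^+ 2 =
    nA u ^+ 2 - 2 * t * normc (ip u v) ^+ 2
      + t ^+ 2 * normc (ip u v) ^+ 2 * nA v ^+ 2.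
Proof.
apply: complexI; rewrite -A_inner_diag -scaleNr.
rewrite !(A_innerDl, A_innerDr, A_innerZl, A_innerZr) !A_inner_diag.
rewrite (A_innerC v u); case: (ip u v) => a b /=.
rewrite sqr_sqrtr ?addr_ge0 ?sqr_ge0//.
by simpc; congr (_ +i* _)%C; ring.
Qed.

(** As [nA] is only a seminorm, the case [nA v = 0] needs an argument of its own:
    the square of [nA (u - t (ip u v) v)] cannot decrease without bound in [t]. *)
Lemma A_cauchy_schwarz u v : normc (ip u v) <= nA u * nA v.
Proof.
have quad t := A_norm_sub_sqr u v t.
have pos t := sqr_ge0 (nA (u - (t%:C * ip u v) *: v)).
rewrite -ler_sqr ?nnegrE ?mulr_ge0 ?A_norm_ge0 ?normc_ge0// exprMn.
have [v0|v0] := eqVneq (nA v) 0.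
  have [->|q0] := eqVneq (normc (ip u v)) 0.
    by rewrite expr0n/= mulr_ge0 ?sqr_ge0.
  (* The square of the seminorm is affine in [t]; this [t] makes it -1. *)
  pose t := (nA u ^+ 2 + 1) / (2 * normc (ip u v) ^+ 2).
  have sqrN1 : nA (u - (t%:C * ip u v) *: v) ^+ 2 = - 1.
    by rewrite quad v0 /t; field; rewrite q0.
  by have := pos t; rewrite sqrN1; lra.
have := pos ((nA v ^+ 2)^-1); rewrite quad.
have v2 : 0 < nA v ^+ 2 by rewrite exprn_gt0// lt_def v0 A_norm_ge0.
have v2_neq0 : nA v ^+ 2 != 0 by rewrite gt_eqF.
have -> : nA u ^+ 2 - 2 * (nA v ^+ 2)^-1 * normc (ip u v) ^+ 2 +
    (nA v ^+ 2)^-1 ^+ 2 * normc (ip u v) ^+ 2 * nA v ^+ 2 =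
    nA u ^+ 2 - normc (ip u v) ^+ 2 / nA v ^+ 2 by field.
by rewrite subr_ge0 ler_pdivrMr.
Qed.

(** Buzano's inequality is Cauchy-Schwarz for [v] and the image of [u] under the
    reflection [u |-> u - 2 (ip u f) f]. *)
Lemma A_buzano u v f : nA f = 1 ->
  2 * (normc (ip u f) * normc (ip f v)) <= nA u * nA v + normc (ip u v).
Proof.
move=> f1; set w := u - ((2%:R : R)%:C * ip u f) *: f.
have wu : nA w = nA u.
  apply/eqP; rewrite -(eqrXn2 (n := 2))// ?A_norm_ge0// A_norm_sub_sqr f1.
  by apply/eqP; ring.
have E : (2%:R : R)%:C * (ip u f * ip f v) = ip u v - ip w v.
  rewrite /w -scaleNr A_innerDl A_innerZl; ring.
have := congr1 (@normc R) E; rewrite !normcM normc_real// => ->.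
apply: (le_trans (le_normcD _ _)).
by rewrite normcN addrC lerD// -wu A_cauchy_schwarz.
Qed.

(** With [Y] a sharp of [T] this expresses adjointness for the form of [A], and
    with [Y = T] it expresses symmetry for that form. *)
Lemma adjoint_transfer T Ts Y : is_adjoint T Ts -> A \o Y = Ts \o A ->
  forall u v, ip (T u) v = ip u (Y v).
Proof.
move=> adjT AY u v; rewrite A_innerC (A_innerC u) /A_inner -!rkhs_innerC adjT.
by rewrite -[Ts (A v)]/((Ts \o A) v) -AY.
Qed.

Lemma A_selfadjoint_symmetric P : A_selfadjoint A P -> A_symmetric A P.
Proof. by case=> Ps adjP AP u v; exact: adjoint_transfer AP u v. Qed.

Lemma is_sharp_inner T Y : is_sharp A T Y ->
  forall u v, ip (T u) v = ip u (Y v).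
Proof. by case=> _ [Ts adjT AY] _ u v; exact: adjoint_transfer AY u v. Qed.

Lemma is_sharp_inner_sharp T Y : is_sharp A T Y ->
  forall u v, ip (Y u) v = ip u (T v).
Proof. by move=> sTY u v; rewrite A_innerC -(is_sharp_inner sTY) -A_innerC. Qed.

Section Projection.
Context {P : H -> H}.
Hypotheses (P_sym : A_symmetric A P) (P_idem : forall u, P (P u) = P u).

Lemma A_projection_diag u : ip (P u) u = (nA (P u) ^+ 2)%:C.
Proof. by rewrite -A_inner_diag (P_sym u (P u)) P_idem P_sym. Qed.

Lemma A_projection_contraction u : nA (P u) <= nA u.
Proof.
have [->|Pu] := eqVneq (nA (P u)) 0; first exact: A_norm_ge0.
rewrite -(@ler_pM2l _ (nA (P u))) ?lt_def ?Pu ?A_norm_ge0//.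
have := A_cauchy_schwarz (P u) u; rewrite A_projection_diag.
by rewrite normc_real ?sqr_ge0// expr2.
Qed.

End Projection.

Lemma A_ginv_projection T G : is_A_ginv A T G ->
  (forall u, ip (T (G u)) u = (nA (T (G u)) ^+ 2)%:C) /\
  forall u, nA (T (G u)) <= nA u.
Proof.
case=> _ TGT _ /A_selfadjoint_symmetric TG_sym _.
have TG_idem u : (T \o G) ((T \o G) u) = (T \o G) u by rewrite /= -[in RHS]TGT.
by split=> u; [exact: (A_projection_diag TG_sym TG_idem)
  |exact: (A_projection_contraction TG_sym TG_idem)].
Qed.

(** The right factor is the seminorm of the projection [T G u], not of [u]: this
    is where the generalized inverse enters. *)
Lemma A_ginv_mixed_schwarz T G u : is_A_ginv A T G ->
  normc (ip (T u) u) <= nA (T u) * nA (T (G u)).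
Proof.
case=> _ TGT _ /A_selfadjoint_symmetric TG _.
have TGTu : T (G (T u)) = T u by rewrite -[in RHS]TGT.
by rewrite -{1}TGTu (TG (T u) u) A_cauchy_schwarz.
Qed.

(** After expanding the square of [|ip (Mf) f| + |ip (Nf) f|], each square is
    bounded by the mixed Cauchy-Schwarz inequality followed by
    [y^2 z^2 <= (y^4 + z^4) / 2], and the double product by Buzano's inequality. *)
Lemma A_inner_add_sqr M N Mg Ng f :
  is_A_ginv A M Mg -> is_A_ginv A N Ng -> nA f = 1 ->
  normc (ip (M f + N f) f) ^+ 2 <=
    2^-1 * (((nA (M f) ^+ 2) ^+ 2 + (nA (N f) ^+ 2) ^+ 2)
            + ((nA (M (Mg f)) ^+ 2) ^+ 2 + (nA (N (Ng f)) ^+ 2) ^+ 2))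
    + normc (ip (M f) (N f)) + nA (M f) * nA (N f).
Proof.
move=> Mg_ginv Ng_ginv f1; rewrite A_innerDl.
have Mfb := A_ginv_mixed_schwarz f Mg_ginv.
have Nfb := A_ginv_mixed_schwarz f Ng_ginv.
have cross := A_buzano (M f) (N f) f1; rewrite (normc_A_innerC f) in cross.
have am_gm (x y z : R) : 0 <= x -> x <= y * z ->
    x ^+ 2 <= 2^-1 * ((y ^+ 2) ^+ 2 + (z ^+ 2) ^+ 2).
  move=> x_ge0 xyz; apply: (@le_trans _ _ ((y * z) ^+ 2)).
    by rewrite ler_sqr ?nnegrE// (le_trans x_ge0).
  by have := sqr_ge0 (y ^+ 2 - z ^+ 2); nra.
have {}Mfb := am_gm _ _ _ (normc_ge0 _) Mfb.
have {}Nfb := am_gm _ _ _ (normc_ge0 _) Nfb.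
apply: (@le_trans _ _ ((normc (ip (M f) f) + normc (ip (N f) f)) ^+ 2)).
  by rewrite ler_sqr ?nnegrE ?addr_ge0 ?normc_ge0//; exact: le_normcD.
rewrite sqrrD; lra.
Qed.

End SemiInner.

(** * Boundedness for the seminorm *)

Section Bounds.
Context {R : realType} {X : Type} {H : rkhs R X}.
Implicit Types (A T S Y : H -> H) (u v : H).

(** The inner product and the norm of the space are those of the identity, so
    that Cauchy-Schwarz also applies to them, with real-valued norms. *)
Lemma positive_op_id : positive_op (fun u : H => u).
Proof.
split=> [|u]; first by split => // u; exact: cvg_id.
by rewrite -rkhs_normE exprn_ge0.
Qed.

Local Notation nH := (A_norm (fun u : H => u)).

Lemma rkhs_normcE u : `|u| = (nH u)%:C.
Proof.
apply/eqP; rewrite -(eqrXn2 (n := 2))// ?ler0c ?A_norm_ge0//.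
by rewrite rkhs_normE -rmorphXn /= -(A_inner_diag positive_op_id).
Qed.

Lemma bounded_opP T : bounded_op T ->
  exists2 c : R, 0 < c & forall u, nH (T u) <= c * nH u.
Proof.
case=> T_lin T_cont.
pose f : {linear H -> H} := HB.pack T (GRing.isLinear.Build _ _ _ _ T T_lin).
have [[c d] c_gt0 Tc] := @linear_lipschitz _ _ _ f T_cont.
move: c_gt0; rewrite ltcE /= => /andP[/eqP d0 c_gt0]; exists c => // u.
by have := Tc u; rewrite d0 !rkhs_normcE -[_ +i* _]/(c%:C) -rmorphM lecR.
Qed.

Lemma bounded_op_comp T S : bounded_op T -> bounded_op S -> bounded_op (T \o S).
Proof.
case=> T_lin T_cont [S_lin S_cont]; split=> [a u v|u] /=.
  by rewrite S_lin T_lin.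
by apply: continuous_comp; [exact: S_cont|exact: T_cont].
Qed.

Lemma A_norm_le_norm A : positive_op A ->
  exists2 d : R, 0 <= d & forall u, A_norm A u <= d * nH u.
Proof.
move=> A_pos; have [c c_gt0 Ac] := bounded_opP A_pos.1.
exists (Num.sqrt c) => [|u]; first exact: sqrtr_ge0.
rewrite -ler_sqr ?nnegrE ?mulr_ge0 ?sqrtr_ge0 ?A_norm_ge0//.
rewrite exprMn (sqr_sqrtr (ltW c_gt0)).
have := A_cauchy_schwarz positive_op_id (A u) u.
rewrite -[A_inner _ _ _]/(A_inner A u u) (normc_A_inner_diag A_pos).
move=> Auu; apply: le_trans Auu _.
by rewrite expr2 mulrA ler_wpM2r ?A_norm_ge0.
Qed.

(** By symmetry [nA (S^(m+1) u)^2 = ip (S^m u) (S^(m+2) u)]. *)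
Lemma A_symmetric_log_convex A S u m : positive_op A -> A_symmetric A S ->
  A_norm A (iter m.+1 S u) ^+ 2 <=
    A_norm A (iter m S u) * A_norm A (iter m.+2 S u).
Proof.
move=> A_pos S_sym; have := A_cauchy_schwarz A_pos (iter m S u) (iter m.+2 S u).
rewrite [iter m.+2 _ _]iterS -S_sym -[S (iter m S u)]iterS.
by rewrite normc_A_inner_diag.
Qed.

(** The theorem of Krein and Lax.  If [x n] is the seminorm of [S^n u] and
    [r = x 1 / x 0], convexity gives [r^n x 0 <= x n], while the bound [c] of [S]
    for the norm and the continuity of the seminorm give [x n = O(c^n)]; so
    [r <= c]. *)
Lemma A_symmetric_bounded A S : positive_op A -> bounded_op S ->
  A_symmetric A S ->
  exists2 c : R, 0 < c & forall u, A_norm A (S u) <= c * A_norm A u.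
Proof.
move=> A_pos S_bd S_sym.
have [c c_gt0 Sc] := bounded_opP S_bd.
have [d d_ge0 Ad] := A_norm_le_norm A_pos.
exists c => // u; pose x n := A_norm A (iter n S u).
have x_ge0 n : 0 <= x n by exact: A_norm_ge0.
have convex n : x n.+1 ^+ 2 <= x n * x n.+2 by exact: A_symmetric_log_convex.
(* On a null vector [u] of the seminorm, [nA (S u)^2 = ip u (S (S u)) = 0]. *)
have [x0|x0] := eqVneq (x 0%N) 0.
  have := A_cauchy_schwarz A_pos u (S (S u)).
  rewrite -S_sym normc_A_inner_diag// -[A_norm A u]/(x 0%N) x0 mul0r => le0.
  rewrite mulr0 leNgt; apply/negP => Su_gt0.
  by move: le0; rewrite leNgt exprn_gt0.
have x0_gt0 : 0 < x 0%N by rewrite lt_def x0 x_ge0.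
rewrite -ler_pdivrMr//; set r := _ / _.
have [->|r_neq0] := eqVneq r 0; first exact: ltW.
have r_gt0 : 0 < r by rewrite lt_def r_neq0 divr_ge0 ?A_norm_ge0.
(* By convexity the ratios [x n.+1 / x n] are nondecreasing. *)
have growth n : r * x n <= x n.+1 /\ 0 < x n.+1.
  elim: n => [|n [IH xn1]].
    have E : r * x 0%N = x 1%N by rewrite divfK.
    by rewrite E lexx -E mulr_gt0.
  have xn2 : r * x n.+1 <= x n.+2.
    have xn_ge0 := x_ge0 n; have cn := convex n.
    have xn : 0 < x n by have := x_ge0 n.+2; nra.
    rewrite -(ler_pM2l xn); apply: le_trans cn.
    by rewrite expr2 mulrA ler_pM2r// mulrC.
  by split=> //; apply: lt_le_trans xn2; rewrite mulr_gt0.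
apply: (@geometric_dominated _ _ _ (x 0%N) (d * nH u)) => // n.
apply: (@le_trans _ _ (x n)).
  elim: n => [|n IH]; first by rewrite expr0 mul1r.
  by apply: le_trans (growth n).1; rewrite exprS -mulrA ler_pM2l.
apply: le_trans (Ad _) _; rewrite -mulrA ler_wpM2l//.
elim: n => [|n IH]; first by rewrite expr0 mulr1.
apply: le_trans (Sc _) _.
by rewrite exprS mulrCA ler_pM2l.
Qed.

(** [Y T] is symmetric for the form of [A], and [nA (T u)^2 = ip u (Y T u)]. *)
Lemma is_sharp_A_bounded A T Y : positive_op A -> bounded_op T ->
  is_sharp A T Y ->
  exists2 c : R, 0 <= c & forall u, A_norm A (T u) <= c * A_norm A u.
Proof.
move=> A_pos T_bd sTY; have Y_bd : bounded_op Y by case: sTY.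
have YT_sym : A_symmetric A (Y \o T).
  move=> u v /=.
  by rewrite (is_sharp_inner_sharp A_pos sTY) (is_sharp_inner A_pos sTY).
have [c c_gt0 YTc] :=
  A_symmetric_bounded A_pos (bounded_op_comp Y_bd T_bd) YT_sym.
exists (Num.sqrt c) => [|u]; first exact: sqrtr_ge0.
rewrite -ler_sqr ?nnegrE ?mulr_ge0 ?sqrtr_ge0 ?A_norm_ge0//.
rewrite exprMn (sqr_sqrtr (ltW c_gt0)).
have := A_cauchy_schwarz A_pos u (Y (T u)).
rewrite -(is_sharp_inner A_pos sTY) normc_A_inner_diag// => Tu.
apply: le_trans Tu _.
by rewrite [leRHS]mulrC expr2 -mulrA ler_wpM2l ?A_norm_ge0// mulrC YTc.
Qed.

End Bounds.

(** * Berezin numbers *)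

Section Berezin.
Context {R : realType} {X : Type} {H : rkhs R X} {k : X -> H} {A : H -> H}.
Context (A_pos : positive_op A).
Implicit Types (T S Y Z : H -> H) (f : H) (B : R).

Lemma A_norm_normalized x : A_norm A (k x) != 0 ->
  A_norm A (A_normalized A k x) = 1.
Proof.
move=> kx; apply/eqP; rewrite -(eqrXn2 (n := 2))// ?A_norm_ge0// expr1n.
apply/eqP/complexI; rewrite -A_inner_diag// A_innerZl// A_innerZr//.
rewrite A_inner_diag// conjc_real -!rmorphM; congr (_%:C).
by field.
Qed.

Lemma ber_ge0 T : 0 <= ber k A T.
Proof.
rewrite /ber; set E := [set _ | _ in _].
have [E_sup|E_sup] := pselect (has_sup E); last by rewrite sup_out.
have [[y [x kx xy]] E_ub] := E_sup.
have Ey : E y by exists x.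
by apply: le_trans (ub_le_sup E_ub Ey); rewrite -xy; exact: normc_ge0.
Qed.

Lemma ber_le T B : 0 <= B ->
  (forall x, A_norm A (k x) != 0 ->
    normc (A_inner A (T (A_normalized A k x)) (A_normalized A k x)) <= B) ->
  ber k A T <= B.
Proof.
move=> B_ge0 TB; rewrite /ber; set E := [set _ | _ in _].
have [[y Ey]|] := pselect (E !=set0); last first.
  by move=> E0; rewrite sup_out// => -[].
by apply: ge_sup; [exists y | move=> _ [x kx <-]; exact: TB].
Qed.

(** The set defining [ber k A T] is then bounded for every choice of [k], so that
    its supremum is an upper bound of it. *)
Definition A_numerically_bounded T :=
  exists B, forall f, A_norm A f = 1 -> normc (A_inner A (T f) f) <= B.

Lemma le_ber T x : A_numerically_bounded T -> A_norm A (k x) != 0 ->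
  normc (A_inner A (T (A_normalized A k x)) (A_normalized A k x)) <= ber k A T.
Proof.
move=> [B TB] kx; apply: ub_le_sup; last by exists x.
by exists B => _ [y ky <-]; apply: TB; exact: A_norm_normalized.
Qed.

Lemma A_numerically_bounded_addZ (a : R[i]) T S :
  A_numerically_bounded T -> A_numerically_bounded S ->
  A_numerically_bounded (fun u => T u + a *: S u).
Proof.
move=> [B TB] [C SC]; exists (B + normc a * C) => f f1.
rewrite A_innerDl// A_innerZl//; apply: le_trans (le_normcD _ _) _.
by rewrite normcM lerD ?TB// ler_wpM2l ?normc_ge0 ?SC.
Qed.

Lemma A_numerically_bounded_sharp T S Y Z :
  bounded_op T -> bounded_op S -> is_sharp A T Y -> is_sharp A S Z ->
  A_numerically_bounded (fun u => Z (T u)).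
Proof.
move=> T_bd S_bd sTY sSZ.
have [c c_ge0 Tc] := is_sharp_A_bounded A_pos T_bd sTY.
have [d d_ge0 Sd] := is_sharp_A_bounded A_pos S_bd sSZ.
exists (c * d) => f f1; rewrite (is_sharp_inner_sharp A_pos sSZ).
apply: le_trans (A_cauchy_schwarz A_pos _ _) _.
have := Tc f; have := Sd f; rewrite f1 !mulr1 => Sfd Tfc.
by rewrite ler_pM ?A_norm_ge0.
Qed.

Lemma A_numerically_bounded_ginv T S :
  is_A_ginv A T S -> A_numerically_bounded (fun u => T (S u)).
Proof.
move=> TS; exists 1 => f f1; have [diag contr] := A_ginv_projection A_pos TS.
rewrite diag normc_real ?sqr_ge0// -(expr1n R 2).
by rewrite ler_sqr ?nnegrE ?A_norm_ge0// -f1.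
Qed.

End Berezin.

Theorem theorem3p1 (R : realType) (X : Type) (X_nonempty : inhabited X)
    (H : rkhs R X) (k : X -> H) (k_kernel : is_reproducing_kernel k)
    (A : H -> H) (A_pos : positive_op A)
    (M N : H -> H) (M_BA : in_BA A M) (N_BA : in_BA A N)
    (M_closed : closed (range M)) (N_closed : closed (range N))
    (M_range_compat : compatible A (range M))
    (M_null_compat : compatible A (null_space M))
    (N_range_compat : compatible A (range N))
    (N_null_compat : compatible A (null_space N))
    (Ms Ns : H -> H) (Ms_sharp : is_sharp A M Ms) (Ns_sharp : is_sharp A N Ns)
    (Mg Ng : H -> H) (Mg_ginv : is_A_ginv A M Mg) (Ng_ginv : is_A_ginv A N Ng) :
  ber k A (fun u => M u + N u) ^+ 2 <=
    2^-1 * (ber k A (fun u => Ms (M u) + 'i%C *: Ns (N u)) ^+ 2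
            + ber k A (fun u => M (Mg u) + 'i%C *: N (Ng u)) ^+ 2)
    + ber k A (fun u => Ns (M u))
    + Num.sqrt (ber k A (fun u => Ms (M u)) * ber k A (fun u => Ns (N u))).
Proof.
have [M_bd N_bd] : bounded_op M /\ bounded_op N by case: M_BA N_BA => + _ [].
have MM f : A_inner A (Ms (M f)) f = (A_norm A (M f) ^+ 2)%:C.
  by rewrite (is_sharp_inner_sharp A_pos Ms_sharp) A_inner_diag.
have NN f : A_inner A (Ns (N f)) f = (A_norm A (N f) ^+ 2)%:C.
  by rewrite (is_sharp_inner_sharp A_pos Ns_sharp) A_inner_diag.
have [MgP _] := A_ginv_projection A_pos Mg_ginv.
have [NgP _] := A_ginv_projection A_pos Ng_ginv.
have MM_bd := A_numerically_bounded_sharp A_pos M_bd M_bd Ms_sharp Ms_sharp.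
have NN_bd := A_numerically_bounded_sharp A_pos N_bd N_bd Ns_sharp Ns_sharp.
have NM_bd := A_numerically_bounded_sharp A_pos M_bd N_bd Ms_sharp Ns_sharp.
have S_bd := A_numerically_bounded_addZ A_pos 'i%C MM_bd NN_bd.
have P_bd := A_numerically_bounded_addZ A_pos 'i%C
  (A_numerically_bounded_ginv A_pos Mg_ginv)
  (A_numerically_bounded_ginv A_pos Ng_ginv).
set B := leRHS.
have B_ge0 : 0 <= B.
  rewrite /B !addr_ge0 ?sqrtr_ge0 ?ber_ge0//.
  by rewrite mulr_ge0 ?addr_ge0 ?sqr_ge0 ?invr_ge0.
rewrite -(sqr_sqrtr B_ge0) ler_sqr ?nnegrE ?sqrtr_ge0 ?ber_ge0//.
apply: ber_le => [|x kx]; first exact: sqrtr_ge0.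
rewrite -ler_sqr ?nnegrE ?sqrtr_ge0 ?normc_ge0// (sqr_sqrtr B_ge0) /B.
have f1 := A_norm_normalized A_pos kx.
have := (le_ber A_pos MM_bd kx, le_ber A_pos NN_bd kx, le_ber A_pos NM_bd kx).
have := (le_ber A_pos S_bd kx, le_ber A_pos P_bd kx).
move: (A_normalized A k x) f1 => f f1 [Sf Pf] [[MMf NNf] NMf].
apply: le_trans (A_inner_add_sqr A_pos Mg_ginv Ng_ginv f1) _.
rewrite -(normc_sqr_addi (A_norm A (M f) ^+ 2)).
rewrite -(normc_sqr_addi (A_norm A (M (Mg f)) ^+ 2)) -MM -NN -MgP -NgP.
rewrite -!(A_innerZl A_pos) -!(A_innerDl A_pos).
rewrite -(is_sharp_inner_sharp A_pos Ns_sharp).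
rewrite !lerD ?ler_wpM2l ?invr_ge0 ?lerD ?ler_sqr ?nnegrE ?normc_ge0 ?ber_ge0//.
rewrite -[leLHS]ger0_norm ?mulr_ge0 ?A_norm_ge0// -sqrtr_sqr exprMn.
rewrite ler_sqrt ?mulr_ge0 ?ber_ge0//.
move: MMf NNf; rewrite MM NN !normc_real ?sqr_ge0// => MMf NNf.
by rewrite ler_pM ?sqr_ge0.
Qed.
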